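(* Let $K$ be a field of characteristic $2$, let $n>1$ be an integer, and let $$G=\langle a,b \mid a^{2^n}=b^2=c^2=d^2=1,\ (a,b)=c,\ (a,c)=d,\ (a,d)=(b,c)=(b,d)=(c,d)=1\rangle,$$ where $c$ denotes the commutator $(a,b)$ and $d$ denotes the commutator $(a,c)$. Then the group algebra $KG$ has no filtered multiplicative $K$-basis.
   Context: Let $A$ be a finite-dimensional (associative, unital) algebra over a field $K$. A $K$-basis $B$ of $A$ is called a filtered multiplicative $K$-basis of $A$ if: (1) whenever $u,v\in B$, either $uv=0$ or $uv\in B$; and (2) $B\cap \mathrm{rad}(A)$ is a $K$-basis of $\mathrm{rad}(A)$, where $\mathrm{rad}(A)$ is the Jacobson radical of $A$. Notation: $(x,y)=x^{-1}y^{-1}xy$ is the commutator. *)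

(* Defs.v *)
From HB Require Import structures.
From mathcomp Require Import all_boot all_order all_algebra all_fingroup all_field.
From mathcomp Require Import boolp.

Set Implicit Arguments.
Unset Strict Implicit.
Unset Printing Implicit Defensive.

Import GRing.Theory.
Local Open Scope ring_scope.

(* The function x stands for \sum_g x(g) g.  A new constant is needed because
   {ffun gT -> K^o} already carries the pointwise product. *)
Definition group_algebra (K : fieldType) (gT : finGroupType) : Type :=
  {ffun gT -> K^o}.

Section GroupAlgebra.
Variables (K : fieldType) (gT : finGroupType).
Local Notation KG := (group_algebra K gT).

HB.instance Definition _ := Vector.copy (group_algebra K gT) {ffun gT -> K^o}.

Implicit Types x y z : {ffun gT -> K^o}.

Definition ga_elt (g : gT) : KG := [ffun h => ((h == g)%:R : K^o)].
Definition ga_one : KG := ga_elt 1%g.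
Definition ga_mul (x y : {ffun gT -> K^o}) : KG :=
  [ffun g => (\sum_h (x h : K) * (y (h^-1 * g)%g : K) : K^o)].

Lemma ga_mulA : associative (ga_mul : KG -> KG -> KG).
Proof.
move=> x y z; apply/ffunP=> g; rewrite !ffunE.
under eq_bigr do rewrite ffunE mulr_sumr.
under [RHS]eq_bigr do rewrite ffunE mulr_suml.
rewrite [RHS]exchange_big /=; apply: eq_bigr => h _.
rewrite (reindex_inj (mulgI h^-1%g)) /=; apply: eq_bigr => k _.
by rewrite mulrA invMg invgK mulgA mulgK.
Qed.

Lemma ga_mul1x : left_id ga_one (ga_mul : KG -> KG -> KG).
Proof.
move=> x; apply/ffunP=> g; rewrite ffunE (bigD1 1%g) //= ffunE eqxx mul1r.
rewrite invg1 mul1g big1 ?addr0 // => h h1.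
by rewrite ffunE (negPf h1) mul0r.
Qed.

Lemma ga_mulx1 : right_id ga_one (ga_mul : KG -> KG -> KG).
Proof.
move=> x; apply/ffunP=> g; rewrite ffunE (bigD1 g) //= ffunE mulVg eqxx mulr1.
rewrite big1 ?addr0 // => h h1.
by rewrite ffunE -eq_mulVg1 (negPf h1) mulr0.
Qed.

Lemma ga_mulDl : left_distributive (ga_mul : KG -> KG -> KG) +%R.
Proof.
move=> x y z; apply/ffunP=> g; rewrite !ffunE -big_split /=.
by apply: eq_bigr => h _; rewrite ffunE mulrDl.
Qed.

Lemma ga_mulDr : right_distributive (ga_mul : KG -> KG -> KG) +%R.
Proof.
move=> x y z; apply/ffunP=> g; rewrite !ffunE -big_split /=.
by apply: eq_bigr => h _; rewrite ffunE mulrDr.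
Qed.

Lemma ga_one_neq0 : ga_one != 0 :> KG.
Proof.
apply/eqP=> /ffunP/(_ 1%g); rewrite !ffunE eqxx => /eqP.
by rewrite oner_eq0.
Qed.

HB.instance Definition _ := GRing.Zmodule_isNzRing.Build KG
  ga_mulA ga_mul1x ga_mulx1 ga_mulDl ga_mulDr ga_one_neq0.

Lemma ga_scaleAl (a : K) (x y : KG) : a *: (x * y) = (a *: x) * y.
Proof.
apply/ffunP=> g; rewrite !ffunE scaler_sumr.
by apply: eq_bigr => h _; rewrite ffunE; exact: mulrA.
Qed.

HB.instance Definition _ := GRing.Lmodule_isLalgebra.Build K KG ga_scaleAl.

Lemma ga_scaleAr (a : K) (x y : KG) : a *: (x * y) = x * (a *: y).
Proof.
apply/ffunP=> g; rewrite !ffunE scaler_sumr.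
by apply: eq_bigr => h _; rewrite ffunE; exact: mulrCA.
Qed.

HB.instance Definition _ := GRing.Lalgebra_isAlgebra.Build K KG ga_scaleAr.
HB.instance Definition _ := Algebra_isFalgebra.Build K KG.

Lemma ga_eltM (g h : gT) : ga_elt (g * h)%g = ga_elt g * ga_elt h.
Proof.
apply/ffunP=> k; rewrite !ffunE (bigD1 g) //= !ffunE eqxx mul1r.
rewrite big1 ?addr0; first by rewrite -(inj_eq (mulgI g^-1%g)) mulKg.
by move=> l lg; rewrite ffunE (negPf lg) mul0r.
Qed.

Lemma ga_sum_elt (x : KG) :
  x = \sum_(g : gT) ((x : {ffun gT -> K^o}) g : K) *: ga_elt g.
Proof.
apply/ffunP=> k; rewrite sum_ffunE (bigD1 k) //= !ffunE eqxx big1 ?addr0.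
  by rewrite /GRing.scale /= mulr1.
by move=> g gk; rewrite !ffunE eq_sym (negPf gk) scaler0.
Qed.

End GroupAlgebra.

Section FilteredMultiplicativeBasis.
Variables (K : fieldType) (A : falgType K).
Implicit Types (I J : {vspace A}) (B : seq A).

(* A is unital, so its left ideals are automatically K-subspaces. *)
Definition left_ideal I : Prop := ({:A} * I <= I)%VS.

Definition maximal_left_ideal I : Prop :=
  [/\ left_ideal I, I <> fullv &
      forall J, left_ideal J -> (I <= J)%VS -> J = I \/ J = fullv].

Lemma jacobson_radical_exists :
  exists J, forall x : A,
    x \in J <-> (forall I, maximal_left_ideal I -> x \in I).
Proof.
suff main n J : (\dim J < n)%N ->
    (forall x : A, (forall I, maximal_left_ideal I -> x \in I) -> x \in J) ->
    exists J', forall x : A,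
      x \in J' <-> (forall I, maximal_left_ideal I -> x \in I).
  by apply: (main (\dim {:A}).+1 {:A}%VS) => // x _; rewrite memvf.
elim: n J => // n IHn J dimJ J_rad.
have [Jmin|] := pselect (forall I, maximal_left_ideal I -> (J <= I)%VS).
  exists J => x; split; last exact: J_rad.
  by move=> xJ I /Jmin/subvP; apply.
move=> /existsNP[I /not_implyP[maxI /negP nJI]].
apply: (IHn (J :&: I)%VS) => [|x radx]; last first.
  by rewrite memv_cap J_rad ?radx.
apply: (leq_trans _ (dimJ : (\dim J <= n)%N));
  rewrite ltn_neqAle dimvS ?capvSl // andbT.
apply: contra nJI => /eqP dimE; apply/capv_idPl/eqP.
by rewrite eqEdim capvSl dimE /=.
Qed.

(* The intersection of all maximal left ideals, see mem_jacobson_radical. *)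
Definition jacobson_radical : {vspace A} := sval (cid jacobson_radical_exists).

Lemma mem_jacobson_radical (x : A) :
  x \in jacobson_radical <-> (forall I, maximal_left_ideal I -> x \in I).
Proof. exact: (svalP (cid jacobson_radical_exists)). Qed.

Definition filtered_multiplicative_basis B : Prop :=
  [/\ basis_of {:A} B,
      {in B &, forall u v, u * v = 0 \/ u * v \in B} &
      basis_of jacobson_radical [seq u <- B | u \in jacobson_radical]].

End FilteredMultiplicativeBasis.

(* Main.v *)
(* The radical J of KG is the augmentation ideal, generated as a left ideal by
   x = a - 1 and y = b - 1, and y^2 = 0.  If u belongs to a filtered
   multiplicative basis B but not to J^k, the functional dual to u kills J^k,
   because B meets J^k in a basis of J^k; so a relation modulo J^k between
   words in elements of B must be trivial.
   Choose U = r x + s y and V = t x + u y modulo J^2 in B, linearly independent.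
   If r t <> 0, the words U^2, UV, VU, V^2 are different modulo J^3, but
   (t U - r V)^2 lies in J^3 since t U - r V is proportional to y modulo J^2.
   Hence V is proportional to y, say t = 0.  Then UVUV + VUVU + VUUV is
   proportional modulo J^5 to (xy + yx)^2 = (ba)^2 (c - 1)(d - 1), which lies in
   J^5.  But VUVU is not in J^5 and differs from the other two words. *)
Require Import Defs.
From HB Require Import structures.
From mathcomp Require Import all_boot all_algebra all_fingroup all_field.
From mathcomp Require Import boolp.

Set Implicit Arguments.
Unset Strict Implicit.
Unset Printing Implicit Defensive.

Import GRing.Theory.

(** * Powers of the radical and filtered multiplicative bases *)

Section FalgebraIdeals.
Local Open Scope ring_scope.
Variables (K : fieldType) (A : falgType K).
Implicit Types (I J M : {vspace A}) (B X Y : seq A).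

Lemma left_idealP I :
  left_ideal I <-> (forall x y : A, y \in I -> x * y \in I).
Proof.
split=> [/prodvP IP x y yI | IP]; first by apply: IP; rewrite ?memvf.
by apply/prodvP => x y _; apply: IP.
Qed.

Lemma left_ideal_jacobson_radical : left_ideal (jacobson_radical A).
Proof.
apply/left_idealP => x y /mem_jacobson_radical yJ.
apply/mem_jacobson_radical => M maxM.
by have [/left_idealP lM _ _] := maxM; apply/lM/yJ.
Qed.

(* Modulo [M] such a [w] is a nilpotent central endomorphism of a simple
   module, and the image of [w] is a submodule on which [w] vanishes. *)
Lemma central_nilpotent_kills_simple M (w : A) :
    maximal_left_ideal M ->
    (forall x, w * (w * x) \in M) ->
    (forall h x, (w * h - h * w) * x \in M) ->
  forall x, w * x \in M.
Proof.
move=> [/left_idealP lM _ maxM] w2 wC.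
have wM m : m \in M -> w * m \in M by apply: lM.
pose M' := (M + limg (amull w))%VS.
have in_limg x : w * x \in limg (amull w).
  by have := memv_img (amull w) (memvf x); rewrite lfunE.
have lM' : left_ideal M'.
  apply/left_idealP => h _ /memv_addP[m mM [_ /memv_imgP[x _ ->] ->]].
  rewrite lfunE /= mulrDr.
  have -> : h * (w * x) = - ((w * h - h * w) * x) + w * (h * x).
    by rewrite mulrBl opprB -!mulrA subrK.
  by rewrite addrA memv_add ?in_limg // rpredB ?wC ?lM.
have [M'E|M'E] := maxM _ lM' (addvSl _ _) => x.
  by rewrite -M'E -[_ * _]add0r memv_add ?mem0v ?in_limg.
have : x \in M' by rewrite M'E memvf.
case/memv_addP=> m mM [_ /memv_imgP[y _ ->] ->].
by rewrite lfunE /= mulrDr rpredD ?w2 ?wM.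
Qed.

Lemma prodv_span_sub X Y (W : {vspace A}) :
  {in X & Y, forall u v, u * v \in W} -> (<<X>> * <<Y>> <= W)%VS.
Proof.
move=> XY; apply/prodvP=> u v uX vY.
rewrite (coord_span (X := in_tuple X) uX) (coord_span (X := in_tuple Y) vY).
rewrite mulr_suml; apply: memv_suml => i _; rewrite mulr_sumr.
apply: memv_suml => j _; rewrite -scalerAl -scalerAr !memvZ //.
by apply: XY; rewrite mem_nth.
Qed.

(** By induction, a product of elements of [B] lying in a power of the radical and in the radical is
    0 or again in [B]. Exponents are positive because the zeroth power is only the line spanned by
    1. *)
Lemma filtered_basis_expv B k : filtered_multiplicative_basis B ->
  (jacobson_radical A ^+ k.+1)%VS =
    <<[seq u <- B | u \in jacobson_radical A ^+ k.+1]>>%VS.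
Proof.
set J := jacobson_radical A => -[_ mulB basisJ].
apply/eqP; rewrite eqEsubv andbC; apply/andP; split.
  by apply/span_subvP=> u; rewrite mem_filter => /andP[].
elim: k => [|k IHk]; first by rewrite (span_basis basisJ).
rewrite expvSr (subv_trans (prodvS IHk (subvv J))) //.
rewrite -[X in (_ * X)%VS](span_basis basisJ); apply: prodv_span_sub => u v.
rewrite !mem_filter => /andP[uJ uB] /andP[vJ vB].
have [->|uvB] := mulB _ _ uB vB; first exact: mem0v.
by apply: memv_span; rewrite mem_filter uvB andbT memv_mul.
Qed.

Lemma filtered_basis_dual B k (u : A) : filtered_multiplicative_basis B ->
    u \in B -> u \notin (jacobson_radical A ^+ k.+1)%VS ->
  exists f : {linear A -> K^o},
    [/\ f u = 1, {in B, forall v, v != u -> f v = 0} &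
        forall z, z \in (jacobson_radical A ^+ k.+1)%VS -> f z = 0].
Proof.
move=> fB uB uJ; have [basisB _ _] := fB.
have [f fP] := linear_of_free B [seq (v == u)%:R : K^o | v <- B].
have {}fP : {in B, forall v, f v = (v == u)%:R}.
  by apply/eq_in_map/fP; rewrite ?size_map // (basis_free basisB).
have f0 v : v \in B -> v != u -> f v = 0.
  by move=> vB vu; rewrite fP // (negPf vu).
exists f; split=> //; first by rewrite fP // eqxx.
move=> z; rewrite (filtered_basis_expv k fB) => zJ.
rewrite (coord_span (X := in_tuple _) zJ).
rewrite linear_sum big1 // => i _; rewrite linearZ.
have := mem_nth 0 (ltn_ord i); rewrite mem_filter => /andP[viJ viB].
rewrite f0 //; [exact: mulr0 | by apply: contraNneq uJ => <-].
Qed.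

(** This is the tool for choosing U and V in [B] with prescribed nonvanishing conditions. *)
Lemma filtered_basis_detect B (f : {linear A -> K^o}) (z : A) :
    filtered_multiplicative_basis B -> z \in jacobson_radical A -> f z != 0 ->
  exists2 u, u \in B & u \in jacobson_radical A /\ f u != 0.
Proof.
move=> [_ _ basisJ]; rewrite -{1}(span_basis basisJ) => zJ fz.
apply: contrapT => noU; case/eqP: fz.
rewrite (coord_span (X := in_tuple _) zJ) linear_sum big1 // => i _.
have := mem_nth 0 (ltn_ord i); rewrite mem_filter => /andP[uJ uB].
set u := nth 0 _ _ in uJ uB *; rewrite linearZ -/u.
have [->|fu] := eqVneq (f u) 0; first exact: mulr0.
by case: noU; exists u.
Qed.

End FalgebraIdeals.

(** * Identities in rings and modules *)

Lemma comm_subr1 (R : pzRingType) (x y : R) :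
  ((x - 1) * y - y * (x - 1) = x * y - y * x)%R.
Proof. by rewrite mulrBl mulrBr mul1r mulr1 opprB addrA subrK. Qed.

Lemma comm_subr11 (R : pzRingType) (x y : R) :
  ((x - 1) * (y - 1) - (y - 1) * (x - 1) = x * y - y * x)%R.
Proof. by rewrite comm_subr1 -opprB comm_subr1 opprB. Qed.

Lemma lin2_mul (K : fieldType) (A : algType K) (x y : A) (r s t u : K) :
  (y * y = 0 -> (r *: x + s *: y) * (t *: x + u *: y) =
    (r * t) *: (x * x) + (r * u) *: (x * y) + (s * t) *: (y * x))%R.
Proof.
move=> y2; rewrite mulrDl !mulrDr -!scalerAl -!scalerAr !scalerA y2.
by rewrite scaler0 addr0.
Qed.

Lemma mul_lin3 (K : fieldType) (A : algType K) (x y : A) (r s t : K) :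
  (y * y = 0 -> y * (r *: (x * x) + s *: (x * y) + t *: (y * x)) =
    r *: (y * x * x) + s *: (y * x * y))%R.
Proof.
by move=> y2; rewrite !mulrDr -!scalerAr !mulrA y2 mul0r scaler0 addr0.
Qed.

Lemma lin2_elim (K : fieldType) (V : lmodType K) (x y : V) (r s t u : K) :
  (t *: (r *: x + s *: y) - r *: (t *: x + u *: y) =
    0 *: x + (t * s - r * u) *: y)%R.
Proof.
rewrite !scalerDr !scalerA [(r * t)%R]mulrC opprD addrACA subrr -scalerBl.
by rewrite scale0r.
Qed.

Lemma lin3_sub (K : fieldType) (V : lmodType K) (k : K) (u v w u' v' w' : V) :
  (u - k *: u' + (v - k *: v') + (w - k *: w') =
    u + v + w - k *: (u' + v' + w'))%R.
Proof. by rewrite !scalerDr !opprD [RHS]addrACA [(u + v + _)%R]addrACA. Qed.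

(** Only the word x y y x of the expanded square contains y y; the other three have the shapes UVUV,
    VUVU and VUUV. *)
Lemma sqr_anticomm (R : nzRingType) (x y : R) :
  (y * y = 0 -> (x * y + y * x) * (x * y + y * x) =
    x * y * (x * y) + y * x * (y * x) + y * x * (x * y))%R.
Proof.
move=> y2; rewrite mulrDl !mulrDr [(x * y * (y * x))%R]mulrA.
rewrite -[(x * y * y)%R]mulrA y2 mulr0 mul0r addr0 -addrA.
by rewrite [(_ + y * x * (y * x))%R]addrC addrA.
Qed.

(** * Groups with two generators *)

Section Presentations.
Local Open Scope group_scope.

Lemma gen2_ind (gT : finGroupType) (a b : gT) (P : gT -> Prop) :
    P 1 -> (forall g, P g -> P (g * a)) -> (forall g, P g -> P (g * b)) ->
  forall g, g \in <[a]> <*> <[b]> -> P g.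
Proof.
move=> P1 Pa Pb g; rewrite joing_idl joing_idr => /gen_prodgP[n [c cP ->]].
elim: n c cP => [|n IHn] c cP; first by rewrite big_ord0.
rewrite big_ord_recr /=; have := cP ord_max; rewrite !inE.
by case/orP=> /eqP->; [apply: Pa | apply: Pb]; apply: IHn => i; apply: cP.
Qed.

(* The isomorphism defined by the presentation does not come with its values
   on generators; these are read off the subgroup of [gT * rT] generated by
   [(a, a')] and [(b, b')], which is the graph of the morphism. *)
Lemma graph_morphism (gT rT : finGroupType) (a b : gT) (a' b' : rT) :
    <[a]> <*> <[b]> = setT ->
    (#|<[(a, a')]> <*> <[(b, b')]>| <= #|gT|)%N ->
  exists f : gT -> rT,
    [/\ forall g h, f (g * h) = f g * f h, f a = a' & f b = b'].
Proof.
move=> genG; set P := _ <*> _ => leP.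
have Paa : (a, a') \in P by rewrite mem_gen // inE cycle_id.
have Pbb : (b, b') \in P by rewrite mem_gen // inE cycle_id orbT.
have fstP g : exists s, (g, s) \in P.
  have: g \in <[a]> <*> <[b]> by rewrite genG inE.
  elim/gen2_ind: g / => [|g [s Ps]|g [s Ps]]; first by exists 1; apply: group1.
    by exists (s * a'); apply: (groupM Ps Paa).
  by exists (s * b'); apply: (groupM Ps Pbb).
(* The projection maps [P] onto [gT], so the bound on the order of [P] makes it injective. *)
have fst_inj : {in P &, injective fst}.
  apply/imset_injP; rewrite eqn_leq leq_imset_card (leq_trans leP) //.
  rewrite -cardsT subset_leq_card //; apply/subsetP=> g _.
  by have [s Ps] := fstP g; apply/imsetP; exists (g, s).
have [f fP] := choice fstP; exists f.
have fE g s : (g, s) \in P -> f g = s.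
  by move=> Pgs; have [] := fst_inj _ _ (fP g) Pgs erefl.
by split=> [g h||]; apply: fE => //; apply: (groupM (fP g) (fP h)).
Qed.

End Presentations.

(** * Linear functionals on the group algebra *)

Section GroupAlgebraFunctionals.
Local Open Scope ring_scope.
Variables (K : fieldType) (gT : finGroupType).
Local Notation KG := (group_algebra K gT).
Local Notation E := (@ga_elt K gT).

Definition ga_fun (p : gT -> K) (z : KG) : K^o :=
  \sum_g ((z : {ffun gT -> K^o}) g : K) * p g.

Fact ga_fun_is_linear p : linear (ga_fun p).
Proof.
move=> k z w; rewrite /ga_fun scaler_sumr -big_split /=; apply: eq_bigr => g _.
by rewrite !ffunE mulrDl [_ *: (_ * _)]mulrA.
Qed.

HB.instance Definition _ p :=
  GRing.isLinear.Build K KG K^o *:%R (ga_fun p) (ga_fun_is_linear p).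

Lemma ga_fun_elt p g : ga_fun p (E g) = p g.
Proof.
rewrite /ga_fun (bigD1 g) //= ffunE eqxx mul1r big1 ?addr0 // => h hg.
by rewrite ffunE (negPf hg) mul0r.
Qed.

Lemma ga_fun_mul_elt p z h :
  ga_fun p (z * E h) = ga_fun (fun g => p (g * h)%g) z.
Proof.
rewrite [z]ga_sum_elt mulr_suml !linear_sum; apply: eq_bigr => g _.
by rewrite -scalerAl !linearZ /= -ga_eltM !ga_fun_elt.
Qed.

(** Right multiplication by [E h - 1] acts on functionals as a difference operator: [q] is the
    difference of [p] in the direction [h]. *)
Lemma ga_fun_mul_aug p q z h : (forall g, p (g * h)%g = p g + q g) ->
  ga_fun p (z * (E h - 1)) = ga_fun q z.
Proof.
move=> pq; rewrite mulrBr mulr1 linearB /= ga_fun_mul_elt.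
rewrite /ga_fun -sumrB; apply: eq_bigr => g _.
by rewrite pq mulrDr addrC addKr.
Qed.

Lemma ga_fun_mul_aug0 p z h : (forall g, p (g * h)%g = p g) ->
  ga_fun p (z * (E h - 1)) = 0.
Proof.
move=> ph; rewrite (@ga_fun_mul_aug _ (fun=> 0)) => [|g]; last by rewrite addr0.
by rewrite /ga_fun big1 // => g _; rewrite mulr0.
Qed.

End GroupAlgebraFunctionals.

(** * The radical as augmentation ideal, and its powers *)

Section TwoGeneratorRadical.
Local Open Scope ring_scope.
Variables (K : fieldType) (gT : finGroupType) (a b : gT).
Hypothesis hK : 2%N \in [pchar K].
Hypothesis genG : (<[a]> <*> <[b]> = [set: gT])%g.
Local Notation KG := (group_algebra K gT).
Local Notation E := (@ga_elt K gT).
Local Notation x := (E a - 1).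
Local Notation y := (E b - 1).
Local Notation J := (jacobson_radical KG).
Implicit Types (M : {vspace KG}) (g h : gT) (z w : KG).

Lemma ga_pchar2 : 2%N \in [pchar KG].
Proof. by rewrite pchar_lalg. Qed.

Lemma gen_ind (P : gT -> Prop) :
    P 1%g -> (forall g, P g -> P (g * a)%g) -> (forall g, P g -> P (g * b)%g) ->
  forall g, P g.
Proof. by move=> P1 Pa Pb g; apply: (gen2_ind P1 Pa Pb); rewrite genG inE. Qed.

Lemma ga_ind (P : KG -> Prop) :
    P 0 -> (forall k z w, P z -> P w -> P (k *: z + w)) ->
    (forall g, P (E g)) ->
  forall z, P z.
Proof.
move=> P0 PD PE z; rewrite [z]ga_sum_elt.
elim/big_ind: _ => // [u v Pu Pv|g _]; first by rewrite -[u]scale1r; apply: PD.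
by rewrite -[_ *: _]addr0; apply: PD.
Qed.

(** For a left ideal [M], this says that [g] acts as the identity on the module KG/M. Having it for
    [a], [b] and all maximal [M] puts [x] and [y] in the radical. *)
Definition acts_trivially M g := forall z, (E g - 1) * z \in M.

Lemma acts_trivially1 M : acts_trivially M 1%g.
Proof. by move=> z; rewrite subrr mul0r mem0v. Qed.

Lemma acts_triviallyM M g h : left_ideal M ->
  acts_trivially M g -> acts_trivially M h -> acts_trivially M (g * h)%g.
Proof.
move=> /left_idealP lM tg th z.
have -> : (E (g * h)%g - 1) * z = (E g - 1) * z + E g * ((E h - 1) * z).
  rewrite ga_eltM mulrA -mulrDl mulrBr mulr1; congr (_ * _).
    by rewrite [RHS]addrC addrA subrK.
by apply: rpredD; [apply: tg | apply/lM/th].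
Qed.

Lemma acts_triviallyJ M g h :
  left_ideal M -> acts_trivially M g -> acts_trivially M (g ^ h)%g.
Proof.
move=> /left_idealP lM tg z.
have -> : (E (g ^ h)%g - 1) * z = E h^-1%g * ((E g - 1) * (E h * z)).
  by rewrite !mulrA mulrBr mulr1 [in RHS]mulrBl -!ga_eltM mulVg conjgE mulgA.
by apply/lM/tg.
Qed.

Lemma mul_elt_comm g h : E g * E h - E h * E g = E (h * g)%g * (E [~ g, h] - 1).
Proof. by rewrite mulrBr mulr1 -!ga_eltM -commgC. Qed.

(** In characteristic 2 the square of [E g - 1] is [E (g ^+ 2) - 1], which kills KG/M; the
    commutator conditions make [E g - 1] central on this simple module. *)
Lemma acts_trivially_step M g : maximal_left_ideal M ->
    acts_trivially M (g ^+ 2)%g ->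
    acts_trivially M [~ g, a] -> acts_trivially M [~ g, b] ->
  acts_trivially M g.
Proof.
move=> maxM tg2 tga tgb; have [/left_idealP lM _ _] := maxM.
apply: central_nilpotent_kills_simple => // [z|].
  rewrite mulrA -expr2 (_ : _ ^+ 2 = E (g ^+ 2)%g - 1) //.
  have := pFrobenius_autB_comm ga_pchar2 (commr1 (E g)).
  by rewrite !pFrobenius_autE expr1n => ->; rewrite expr2 -ga_eltM.
(* The commutator with [u] is a derivation, so commutation with [E a] and [E b] modulo [M] extends
   to all words. *)
have leibniz (u w v : KG) :
    u * (w * v) - w * v * u = (u * w - w * u) * v + w * (u * v - v * u).
  by rewrite mulrBl mulrBr !mulrA addrA subrK.
set u := E g - 1.
apply: ga_ind => [z|k w w' IHw IHw' z|].
- by rewrite mulr0 mul0r subr0 mul0r mem0v.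
- rewrite mulrDr [(_ *: _ + _) * u]mulrDl -scalerAl -scalerAr opprD addrACA.
  rewrite -scalerBr mulrDl -scalerAl.
  by apply: rpredD; [apply/rpredZ/IHw | apply: IHw'].
have stepM h w : acts_trivially M [~ g, h] ->
    (forall z, (u * w - w * u) * z \in M) ->
  forall z, (u * (w * E h) - w * E h * u) * z \in M.
  move=> tgh tw z.
  rewrite leibniz.
  have -> : u * E h - E h * u = E g * E h - E h * E g.
    exact: comm_subr1.
  rewrite mul_elt_comm mulrDl; apply: rpredD.
    by rewrite -mulrA; apply: tw.
  by rewrite -!mulrA; apply/lM/lM/tgh.
apply: gen_ind => [z|h IHh|h IHh].
- by rewrite mulr1 mul1r subrr mul0r mem0v.
- by rewrite ga_eltM; apply: stepM.
- by rewrite ga_eltM; apply: stepM.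
Qed.

(** The elements are treated in the order d, c, b, then powers of [a], so that the square and the
    commutators needed at each stage are already known to act trivially. *)
Lemma acts_trivially_gens n M : maximal_left_ideal M ->
    (a ^+ (2 ^ n) = 1 -> b ^+ 2 = 1 -> [~ a, b] ^+ 2 = 1 ->
    [~ a, [~ a, b]] ^+ 2 = 1 -> [~ a, [~ a, [~ a, b]]] = 1 ->
    [~ b, [~ a, b]] = 1 -> [~ b, [~ a, [~ a, b]]] = 1 ->
  acts_trivially M a /\ acts_trivially M b)%g.
Proof.
move=> maxM an b2; set c := [~ a, b]%g; set d := [~ a, c]%g => c2 d2 ad bc bd.
have [lM _ _] := maxM; have tM1 := acts_trivially1 M.
have invI (u : gT) : (u ^+ 2 = 1 -> u^-1 = u)%g.
  by move=> u2; apply/eqP; rewrite eq_invg_mul -expg2 u2.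
have commI (g h : gT) : ([~ g, h] ^+ 2 = 1 -> [~ h, g] = [~ g, h])%g.
  by move=> gh2; rewrite -invg_comm invI.
have comm1 (g h : gT) : ([~ g, h] = 1 -> [~ h, g] = 1)%g.
  by move=> gh1; rewrite -invg_comm gh1 invg1.
have td : acts_trivially M d.
  by apply: (acts_trivially_step maxM);
    [rewrite d2 | rewrite (comm1 _ _ ad) | rewrite (comm1 _ _ bd)]; apply: tM1.
have tc : acts_trivially M c.
  apply: (acts_trivially_step maxM); first by rewrite c2; apply: tM1.
    by rewrite (commI _ _ d2); apply: td.
  by rewrite (comm1 _ _ bc); apply: tM1.
have tb : acts_trivially M b.
  apply: (acts_trivially_step maxM); first by rewrite b2; apply: tM1.
    by rewrite (commI _ _ c2); apply: tc.
  by rewrite commgg; apply: tM1.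
split; last exact: tb.
(* The induction goes from [a ^+ (2 ^ n) = 1] down to [a], each power being the square of the
   next. *)
suff: forall k, (k <= n)%N -> acts_trivially M (a ^+ (2 ^ (n - k)))%g.
  by move=> /(_ n (leqnn n)); rewrite subnn expg1.
elim=> [|k IHk] kn; first by rewrite subn0 an; apply: tM1.
apply: (acts_trivially_step maxM).
- by rewrite -expgM -expnSr -subSn // subSS; apply/IHk/ltnW.
- have /commgP/eqP-> : commute (a ^+ (2 ^ (n - k.+1))) a.
    by apply/commute_sym/commuteX.
  exact: tM1.
(* The commutator with [b] is a conjugate of [b^-1 = b] times [b]. *)
rewrite commgEr invI //.
by apply: acts_triviallyM; [|apply: acts_triviallyJ|].
Qed.

Definition aug_left_ideal : {vspace KG} :=
  (limg (amulr x) + limg (amulr y))%VS.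

Lemma aug_left_idealP z :
  reflect (exists w1 w2, z = w1 * x + w2 * y) (z \in aug_left_ideal).
Proof.
apply: (iffP memv_addP).
  move=> [_ /memv_imgP[w1 _ ->] [_ /memv_imgP[w2 _ ->] ->]].
  by exists w1, w2; rewrite !lfunE.
move=> [w1 [w2 ->]]; exists (w1 * x); last exists (w2 * y) => //.
  by have := memv_img (amulr x) (memvf w1); rewrite lfunE.
by have := memv_img (amulr y) (memvf w2); rewrite lfunE.
Qed.

Local Notation aug := (ga_fun (fun=> 1)).

(** By linearity only group elements matter, and E (g a) - 1 = (E g - 1) + E g (E a - 1) allows
    induction on words. *)
Lemma sub_aug_left_ideal z : z - aug z *: (1 : KG) \in aug_left_ideal.
Proof.
elim/ga_ind: z => [|k z w IHz IHw|g].
- by rewrite linear0 scale0r subr0 mem0v.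
- have -> : k *: z + w - aug (k *: z + w) *: (1 : KG) =
      k *: (z - aug z *: (1 : KG)) + (w - aug w *: (1 : KG)).
    by rewrite linearP scalerDl scalerBr scalerA opprD addrACA.
  by rewrite rpredD ?rpredZ.
rewrite ga_fun_elt scale1r; elim/gen_ind: g => [|g|g].
- by rewrite subrr mem0v.
- move=> /aug_left_idealP[w1 [w2 gE]]; apply/aug_left_idealP.
  exists (w1 + E g), w2; rewrite mulrDl addrAC -gE ga_eltM mulrBr mulr1.
  by rewrite addrC addrA subrK.
move=> /aug_left_idealP[w1 [w2 gE]]; apply/aug_left_idealP.
exists w1, (w2 + E g); rewrite mulrDl addrA -gE ga_eltM mulrBr mulr1.
by rewrite [RHS]addrC addrA subrK.
Qed.

(** The codimension is 1: a left ideal strictly above contains an element of nonzero augmentation,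
    hence a nonzero scalar. *)
Lemma aug_left_ideal_maximal : maximal_left_ideal aug_left_ideal.
Proof.
split.
- apply/left_idealP => h z /aug_left_idealP[w1 [w2 ->]].
  by apply/aug_left_idealP; exists (h * w1), (h * w2); rewrite mulrDr !mulrA.
- move=> LE; have : (1 : KG) \in aug_left_ideal by rewrite LE memvf.
  case/aug_left_idealP=> w1 [w2 /(congr1 (ga_fun (fun=> 1)))].
  rewrite linearD /= !ga_fun_mul_aug0 // ga_fun_elt addr0 => /eqP.
  by rewrite oner_eq0.
move=> N /left_idealP lN LN; have [NL|] := boolP (N <= aug_left_ideal)%VS.
  by left; apply/eqP; rewrite eqEsubv NL.
case/subvPn=> z zN zL; right; apply/eqP; rewrite eqEsubv subvf /=.
have augN : aug z *: (1 : KG) \in N.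
  rewrite -[X in X \in N](subKr z) rpredB //.
  by apply: (subvP LN); apply: sub_aug_left_ideal.
have augz : aug z != 0.
  apply: contraNneq zL => z0.
  by rewrite -[z]subr0 -(scale0r (1 : KG)) -z0 sub_aug_left_ideal.
apply/subvP=> w _; rewrite -[w]mulr1; apply: lN.
by rewrite -[1](scalerK augz) rpredZ.
Qed.

Hypotheses (xJ : x \in J) (yJ : y \in J).

Lemma jacobson_radical_augP z :
  reflect (exists w1 w2, z = w1 * x + w2 * y) (z \in J).
Proof.
apply: (iffP idP) => [zJ|[w1 [w2 ->]]].
  have /mem_jacobson_radical zM := zJ.
  exact/aug_left_idealP/zM/aug_left_ideal_maximal.
have /left_idealP lJ := left_ideal_jacobson_radical KG.
by rewrite rpredD ?lJ.
Qed.

Lemma sub_aug_jacobson_radical z : z - aug z *: (1 : KG) \in J.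
Proof. exact/jacobson_radical_augP/aug_left_idealP/sub_aug_left_ideal. Qed.

Lemma memJ_mul k l z w :
  z \in (J ^+ k)%VS -> w \in (J ^+ l)%VS -> z * w \in (J ^+ (k + l))%VS.
Proof. by move=> zJ wJ; rewrite expvD memv_mul. Qed.

Lemma memJ_mull k z w : w \in (J ^+ k.+1)%VS -> z * w \in (J ^+ k.+1)%VS.
Proof.
move=> wJ; have : z * w \in ({:KG} * J ^+ k.+1)%VS by rewrite memv_mul ?memvf.
apply/subvP; rewrite expvSl prodvA prodvSl //.
exact: left_ideal_jacobson_radical.
Qed.

Lemma memJW k z : z \in (J ^+ k.+2)%VS -> z \in (J ^+ k.+1)%VS.
Proof.
apply/subvP; rewrite expvSl.
by apply/prodvP => u v _ vJ; apply: memJ_mull.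
Qed.

(** Each [w] is a scalar plus an element of [J]. *)
Lemma memJ_mulr k z w : z \in (J ^+ k.+1)%VS -> z * w \in (J ^+ k.+1)%VS.
Proof.
move=> zJ; have -> : z * w = z * (w - aug w *: (1 : KG)) + aug w *: z.
  by rewrite mulrBr -scalerAr mulr1 subrK.
have := sub_aug_jacobson_radical w; set w' := w - _ => w'J.
apply: rpredD; last exact: rpredZ.
by apply: memJW; rewrite -[k.+2]addn1 memJ_mul.
Qed.

Lemma congrJ_mul k l z z' w w' :
    z - z' \in (J ^+ k.+1)%VS -> w - w' \in (J ^+ l.+1)%VS ->
    z' \in (J ^+ k)%VS -> w \in (J ^+ l)%VS ->
  z * w - z' * w' \in (J ^+ (k + l).+1)%VS.
Proof.
move=> zz' ww' z'J wJ.
have -> : z * w - z' * w' = (z - z') * w + z' * (w - w').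
  by rewrite mulrBl mulrBr addrA subrK.
by apply: rpredD; [rewrite -addSn | rewrite -addnS]; apply: memJ_mul.
Qed.

(** Replacing the coefficients of [x] and [y] by their augmentations changes them by elements of
    [J]. *)
Lemma jacobson_radical_mod_sqr z : z \in J ->
  exists r s, z - (r *: x + s *: y) \in (J ^+ 2)%VS.
Proof.
case/jacobson_radical_augP=> w1 [w2 ->]; exists (aug w1), (aug w2).
have subE w u : w * u - aug w *: u = (w - aug w *: (1 : KG)) * u.
  by rewrite mulrBl -scalerAl mul1r.
rewrite opprD addrACA !subE; apply: rpredD; apply: memv_mul => //;
  exact: sub_aug_jacobson_radical.
Qed.

(** Up to a unit, [E [~ g, h] - 1] is the additive commutator of [E g - 1] and [E h - 1]. This puts
    c - 1 in J^2 and d - 1 in J^3. *)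
Lemma commg_memJ k g h :
    E g - 1 \in J -> E h - 1 \in (J ^+ k.+1)%VS ->
  E [~ g, h] - 1 \in (J ^+ k.+2)%VS.
Proof.
move=> gJ hJ.
have -> : E [~ g, h] - 1 = E (h * g)^-1%g *
    ((E g - 1) * (E h - 1) - (E h - 1) * (E g - 1)).
  rewrite comm_subr11 mul_elt_comm mulrA -ga_eltM mulVg.
  by rewrite mul1r.
apply/memJ_mull/memvB; first exact: (memJ_mul (k := 1) (l := k.+1)).
by rewrite -[k.+2]addn1; apply: memJ_mul.
Qed.

(** In characteristic 2, x y + y x is [E (b * a) * (E c - 1)]. In its square, moving the second
    [E (b * a)] leftwards turns c into c d, and (c d - 1)(c - 1) reduces to (c - 1)(d - 1), of depth
    2 + 3. *)
Lemma anticomm_sqrJ :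
    ([~ a, b] ^+ 2 = 1)%g -> ([~ a, [~ a, b]] ^+ 2 = 1)%g ->
    ([~ b, [~ a, b]] = 1)%g -> ([~ [~ a, b], [~ a, [~ a, b]]] = 1)%g ->
  (x * y + y * x) * (x * y + y * x) \in (J ^+ 5)%VS.
Proof.
set c := [~ a, b]%g; set d := [~ a, c]%g => c2 d2 bc cd.
have cJ : E c - 1 \in (J ^+ 2)%VS by exact: (commg_memJ (k := 0) xJ yJ).
have dJ : E d - 1 \in (J ^+ 3)%VS by exact: (commg_memJ (k := 1) xJ cJ).
have -> : x * y + y * x = E (b * a)%g * (E c - 1).
  rewrite -mul_elt_comm -[y * x](oppr_pchar2 ga_pchar2).
  exact: comm_subr11.
(* [b] centralizes [c], and [c ^ a] is [c * d^-1] with [d^-1 = d]. *)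
have cba : (c ^ (b * a) = c * d)%g.
  rewrite conjgM; have /eqP/conjg_fixP-> : [~ c, b]%g = 1%g.
    by rewrite -invg_comm bc invg1.
  apply: (mulgI c^-1%g); rewrite mulKg -commgEl -invg_comm -/d.
  by apply/eqP; rewrite eq_invg_mul -expg2 d2.
have cE : (E c - 1) * E (b * a)%g = E (b * a)%g * (E (c * d)%g - 1).
  by rewrite mulrBl mulrBr mul1r mulr1 -!ga_eltM -cba -conjgC.
(* Since c d c = d, both sides are 1 + c + d + c d in characteristic 2. *)
have cdE : (E (c * d)%g - 1) * (E c - 1) = - ((E c - 1) * (E d - 1)).
  have cdc : (c * d * c = d)%g.
    by move/eqP/commgP: cd => ->; rewrite -mulgA -expg2 c2 mulg1.
  rewrite !mulrBl !mulrBr !mulr1 !mul1r -!ga_eltM cdc.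
  by rewrite !(oppr_pchar2 ga_pchar2) [E d + _]addrC addrACA.
rewrite -mulrA [(E c - 1) * _]mulrA cE -[E _ * _ * _]mulrA cdE.
apply: memJ_mull; apply: memJ_mull; rewrite rpredN.
exact: (memJ_mul (k := 2) (l := 3)).
Qed.

End TwoGeneratorRadical.

(* The actions of [a] (a unipotent Jordan block) and [b] (a translation) on the
   affine space F_2^3, the coset space of <a> in the quotient of order 32. *)
Definition stepA (t : bool * bool * bool) : bool * bool * bool :=
  (t.1.1, t.1.2 (+) t.1.1, t.2 (+) t.1.2).

Definition stepB (t : bool * bool * bool) : bool * bool * bool :=
  (~~ t.1.1, t.1.2, t.2).

(** * Functionals separating words in basis elements *)

Section NoFilteredBasis.
Local Open Scope ring_scope.
Variables (K : fieldType) (gT : finGroupType) (a b : gT).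
Hypothesis hK : 2%N \in [pchar K].
Hypothesis genG : (<[a]> <*> <[b]> = [set: gT])%g.
Local Notation KG := (group_algebra K gT).
Local Notation E := (@ga_elt K gT).
Local Notation x := (E a - 1).
Local Notation y := (E b - 1).
Local Notation J := (jacobson_radical KG).
Hypotheses (xJ : x \in J) (yJ : y \in J).

(** An equivariant map from right multiplication to the affine action; functions of the coordinates
    are pulled back along it. *)
Variable pi : gT -> bool * bool * bool.
Hypothesis pi_a : forall g, pi (g * a)%g = stepA (pi g).
Hypothesis pi_b : forall g, pi (g * b)%g = stepB (pi g).

Local Notation coord1 g := ((pi g).1.1%:R : K).
Local Notation coord2 g := ((pi g).1.2%:R : K).
Local Notation coord3 g := ((pi g).2%:R : K).

(* Weighting the three coordinates by 1, 2, 3, the functional attached to a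
   monomial of weight k vanishes on J^(k+1). *)
Local Notation F0 := (ga_fun (fun=> 1 : K)).
Local Notation F1 := (ga_fun (fun g => coord1 g)).
Local Notation F2 := (ga_fun (fun g => coord2 g)).
Local Notation F3 := (ga_fun (fun g => coord3 g)).
Local Notation F12 := (ga_fun (fun g => coord1 g * coord2 g)).
Local Notation F13 := (ga_fun (fun g => coord1 g * coord3 g)).
Local Notation F23 := (ga_fun (fun g => coord2 g * coord3 g)).
Local Notation F123 := (ga_fun (fun g => coord1 g * coord2 g * coord3 g)).

Ltac coordinatewise :=
  move=> ?; rewrite ?pi_a ?pi_b /stepA /stepB; case: (pi _) => [[[] []] []] /=;
  rewrite ?(mulr0, mul0r, mulr1, addr0, add0r, addrr_pchar2 hK) //.

Lemma F0x z : F0 (z * x) = 0.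
Proof. exact: ga_fun_mul_aug0. Qed.

Lemma F0y z : F0 (z * y) = 0.
Proof. exact: ga_fun_mul_aug0. Qed.

Lemma F1x z : F1 (z * x) = 0.
Proof. by apply: ga_fun_mul_aug0; coordinatewise. Qed.

Lemma F1y z : F1 (z * y) = F0 z.
Proof. by apply: ga_fun_mul_aug; coordinatewise. Qed.

Lemma F2x z : F2 (z * x) = F1 z.
Proof. by apply: ga_fun_mul_aug; coordinatewise. Qed.

Lemma F2y z : F2 (z * y) = 0.
Proof. by apply: ga_fun_mul_aug0; coordinatewise. Qed.

Lemma F3x z : F3 (z * x) = F2 z.
Proof. by apply: ga_fun_mul_aug; coordinatewise. Qed.

Lemma F3y z : F3 (z * y) = 0.
Proof. by apply: ga_fun_mul_aug0; coordinatewise. Qed.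

(** Write X1, X2, X3 for the coordinates. As [a] replaces X2 by X2 + X1, the difference is X1^2,
    equal to X1 because the values are 0 and 1. *)
Lemma F12x z : F12 (z * x) = F1 z.
Proof. by apply: ga_fun_mul_aug; coordinatewise. Qed.

Lemma F12y z : F12 (z * y) = F2 z.
Proof. by apply: ga_fun_mul_aug; coordinatewise. Qed.

Lemma F13x z : F13 (z * x) = F12 z.
Proof. by apply: ga_fun_mul_aug; coordinatewise. Qed.

Lemma F13y z : F13 (z * y) = F3 z.
Proof. by apply: ga_fun_mul_aug; coordinatewise. Qed.

(** The difference of X2 X3 is X2^2 + X1 X3 + X1 X2, where X2^2 = X2; only [F13] has weight 4. *)
Lemma F23x z : F23 (z * x) = F2 z + F13 z + F12 z.
Proof.
rewrite (@ga_fun_mul_aug _ _ _ (fun g => coord2 g + coord1 g * coord3 g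
  + coord1 g * coord2 g)); last by coordinatewise.
by rewrite /ga_fun -!big_split; apply: eq_bigr => g _; rewrite /= !mulrDr.
Qed.

Lemma F23y z : F23 (z * y) = 0.
Proof. by apply: ga_fun_mul_aug0; coordinatewise. Qed.

(** The terms X1 X2^2 and X1^2 X2 of the difference coincide and cancel in characteristic 2. *)
Lemma F123x z : F123 (z * x) = F13 z.
Proof. by apply: ga_fun_mul_aug; coordinatewise. Qed.

Lemma F123y z : F123 (z * y) = F23 z.
Proof. by apply: ga_fun_mul_aug; coordinatewise. Qed.

(** J^(k+2) is J^(k+1) (KG x + KG y), and J^(k+1) absorbs the coefficients on its right. *)
Lemma vanish_step (f : {linear KG -> K^o}) k :
    (forall z, z \in (J ^+ k.+1)%VS -> f (z * x) = 0 /\ f (z * y) = 0) ->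
  forall z, z \in (J ^+ k.+2)%VS -> f z = 0.
Proof.
move=> fxy z zJ; apply/eqP; rewrite -[f z](lfunE f) -memv_ker.
apply: subvP z zJ; rewrite expvSr; apply/prodvP=> u w uJ.
case/(jacobson_radical_augP genG xJ yJ)=> w1 [w2 ->].
rewrite memv_ker lfunE mulrDr linearD !mulrA.
have uJr v : u * v \in (J ^+ k.+1)%VS by apply: (memJ_mulr genG xJ yJ).
by rewrite /= (fxy _ (uJr w1)).1 (fxy _ (uJr w2)).2 addr0.
Qed.

Lemma F0_vanish z : z \in (J ^+ 1)%VS -> F0 z = 0.
Proof.
case/(jacobson_radical_augP genG xJ yJ)=> w1 [w2 ->].
by rewrite linearD /= F0x F0y addr0.
Qed.

Lemma F1_vanish z : z \in (J ^+ 2)%VS -> F1 z = 0.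
Proof. by apply: vanish_step => w wJ; rewrite /= F1x F1y F0_vanish. Qed.

Lemma F2_vanish z : z \in (J ^+ 3)%VS -> F2 z = 0.
Proof. by apply: vanish_step => w wJ; rewrite /= F2x F2y F1_vanish. Qed.

Lemma F3_vanish z : z \in (J ^+ 4)%VS -> F3 z = 0.
Proof. by apply: vanish_step => w wJ; rewrite /= F3x F3y F2_vanish. Qed.

Lemma F12_vanish z : z \in (J ^+ 4)%VS -> F12 z = 0.
Proof.
apply: vanish_step => w wJ.
by rewrite /= F12x F12y F2_vanish ?F1_vanish // memJW.
Qed.

Lemma F13_vanish z : z \in (J ^+ 5)%VS -> F13 z = 0.
Proof.
by apply: vanish_step => w wJ; rewrite /= F13x F13y F12_vanish ?F3_vanish.
Qed.

Lemma F23_vanish z : z \in (J ^+ 6)%VS -> F23 z = 0.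
Proof.
apply: vanish_step => w wJ; rewrite /= F23x F23y F13_vanish //.
have wJ4 := memJW wJ; have wJ3 := memJW wJ4.
by rewrite F2_vanish // F12_vanish // !addr0.
Qed.

Lemma F123_vanish z : z \in (J ^+ 7)%VS -> F123 z = 0.
Proof.
apply: vanish_step => w wJ.
by rewrite /= F123x F123y F23_vanish ?F13_vanish // memJW.
Qed.

Lemma F0_1 : F0 (1 : KG) = 1. Proof. exact: ga_fun_elt. Qed.

Lemma F1_x : F1 x = 0. Proof. by rewrite -[x]mul1r F1x. Qed.

Lemma F1_y : F1 y = 1. Proof. by rewrite -[y]mul1r F1y F0_1. Qed.

Hypothesis b2 : (b ^+ 2 = 1)%g.

Lemma y_sqr : y * y = 0.
Proof.
have := pFrobenius_autB_comm (ga_pchar2 gT hK) (commr1 (E b)).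
by rewrite !pFrobenius_autE expr1n !expr2 -ga_eltM -expg2 b2 subrr.
Qed.

Lemma lin2_memJ (r s : K) : r *: x + s *: y \in J.
Proof. by rewrite rpredD ?rpredZ. Qed.

Lemma congrJ_memJ (k : nat) z z' :
  z - z' \in (J ^+ k.+2)%VS -> z' \in (J ^+ k.+1)%VS -> z \in (J ^+ k.+1)%VS.
Proof. by move=> zz' z'J; rewrite -[z](subrK z') rpredD // memJW. Qed.

Lemma congrJ_lin (f : {linear KG -> K^o}) k z z' :
    (forall w, w \in (J ^+ k)%VS -> f w = 0) ->
  z - z' \in (J ^+ k)%VS -> f z = f z'.
Proof. by move=> f0 /f0/eqP; rewrite linearB subr_eq0 => /eqP. Qed.

Section DegreeTwoWords.
Variables (U V : KG) (r s t u : K).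
Hypotheses (UE : U - (r *: x + s *: y) \in (J ^+ 2)%VS).
Hypotheses (VE : V - (t *: x + u *: y) \in (J ^+ 2)%VS).

Lemma congrJ_mul2 :
  U * V - ((r * t) *: (x * x) + (r * u) *: (x * y) + (s * t) *: (y * x))
    \in (J ^+ 3)%VS.
Proof.
rewrite -(lin2_mul _ _ _ _ _ y_sqr).
apply: (congrJ_mul (k := 1) (l := 1)) => //.
  exact: lin2_memJ.
exact: (congrJ_memJ (k := 0)) (lin2_memJ t u).
Qed.

(** Here and in the next two lemmas the coefficients of y x, x x and x y in U V modulo J^3 are read
    off; for the last two, a left factor [y] first kills the y x term. *)
Lemma F2_mul : F2 (U * V) = s * t.
Proof.
rewrite (congrJ_lin F2_vanish congrJ_mul2) !linearD !linearZ /=.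
rewrite !F2x F2y F1_x F1_y !scaler0 !add0r; exact: mulr1.
Qed.

Lemma F3_mul : F3 (y * (U * V)) = r * t.
Proof.
have UV : y * (U * V) - y * ((r * t) *: (x * x) + (r * u) *: (x * y) +
    (s * t) *: (y * x)) \in (J ^+ 4)%VS.
  rewrite -mulrBr; exact: (memJ_mul (k := 1) (l := 3) yJ congrJ_mul2).
rewrite (congrJ_lin F3_vanish UV) (mul_lin3 _ _ _ _ y_sqr) linearD !linearZ /=.
rewrite F3x F3y F2x F1_y scaler0 addr0; exact: mulr1.
Qed.

Lemma F12_mul : F12 (y * (U * V)) = r * u.
Proof.
have UV : y * (U * V) - y * ((r * t) *: (x * x) + (r * u) *: (x * y) +
    (s * t) *: (y * x)) \in (J ^+ 4)%VS.
  rewrite -mulrBr; exact: (memJ_mul (k := 1) (l := 3) yJ congrJ_mul2).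
rewrite (congrJ_lin F12_vanish UV) (mul_lin3 _ _ _ _ y_sqr) linearD !linearZ /=.
rewrite F12x F12y F2x F1x F1_y scaler0 add0r; exact: mulr1.
Qed.

End DegreeTwoWords.

Variable B : seq KG.
Hypothesis fB : filtered_multiplicative_basis B.

Lemma basis_mul2 U V r s t u :
    U \in B -> V \in B ->
    U - (r *: x + s *: y) \in (J ^+ 2)%VS ->
    V - (t *: x + u *: y) \in (J ^+ 2)%VS ->
  r * u != s * t -> r * t = 0.
Proof.
move=> UB VB UE VE det; apply/eqP/negPn/negP=> rt0.
have [_ mulB _] := fB.
have UVJ : U * V \notin (J ^+ 3)%VS.
  apply: contraNN rt0 => /(memJ_mul (k := 1) yJ) /F3_vanish.
  by rewrite (F3_mul UE VE) => ->.
have UVB : U * V \in B.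
  by have [UV0|] := mulB _ _ UB VB; first by rewrite UV0 mem0v in UVJ.
have [f [fUV f0 fJ]] := filtered_basis_dual fB UVB UVJ.
have f0' u' v' : u' \in B -> v' \in B -> u' * v' != U * V -> f (u' * v') = 0.
  by move=> u'B v'B ne; have [->|/f0->//] := mulB _ _ u'B v'B; apply: linear0.
have [r0 t0] : r != 0 /\ t != 0 by move: rt0; rewrite mulf_eq0 => /norP.
(* If V U, U U or V V were equal to U V, comparing coefficients modulo J^3 would give
   [r * u = s * t]. *)
have fVU : f (V * U) = 0.
  apply: f0' => //; apply: contraNneq det => VU.
  by have := F2_mul VE UE; rewrite VU (F2_mul UE VE) mulrC => ->; rewrite mulrC.
have fUU : f (U * U) = 0.
  apply: f0' => //; apply: contraNneq det => UU.
  have := F3_mul UE UE; rewrite UU (F3_mul UE VE) => /(mulfI r0) tr.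
  have := F12_mul UE UE; rewrite UU (F12_mul UE VE) => /(mulfI r0) us.
  by rewrite us tr mulrC.
have fVV : f (V * V) = 0.
  apply: f0' => //; apply: contraNneq det => VV.
  have := F3_mul VE VE; rewrite VV (F3_mul UE VE) => /(mulIf t0) rt.
  have := F2_mul VE VE; rewrite VV (F2_mul UE VE) => /(mulIf t0) su.
  by rewrite rt su mulrC.
have sqrJ : (t *: U - r *: V) * (t *: U - r *: V) \in (J ^+ 3)%VS.
  have WE : t *: U - r *: V - (0 *: x + (t * s - r * u) *: y) \in (J ^+ 2)%VS.
    rewrite -lin2_elim opprD addrACA -opprD -!scalerBr.
    by apply: memvB; apply: memvZ.
  have := congrJ_mul2 WE WE.
  by rewrite !mul0r mulr0 !scale0r !addr0 subr0.
(* Under [f] only the terms in U V survive, with coefficient - t r, which is nonzero. *)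
have := fJ _ sqrJ.
rewrite mulrBl !mulrBr -!scalerAl -!scalerAr !linearB !linearZ /=.
rewrite fUU fVU fVV fUV !(scaler0, oppr0, addr0, add0r) => /eqP.
by rewrite !scaler_eq0 oppr_eq0 oner_eq0 (negPf t0) (negPf r0).
Qed.

Hypothesis comm_sqrJ : (x * y + y * x) * (x * y + y * x) \in (J ^+ 5)%VS.

Lemma F13_xyxy : F13 (x * y * (x * y)) = 0.
Proof. by rewrite !mulrA F13y F3x F2y. Qed.

Lemma F13_yxyx : F13 (y * x * (y * x)) = 1.
Proof. by rewrite !mulrA F13x F12y F2x F1_y. Qed.

(* [z |-> F123 (y * x * z)] vanishes on J^5; it separates VUVU from VUUV, on
   which [F13] takes the same value. *)
Lemma F123_yxyx : F123 (y * x * (y * x * (y * x))) = 0.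
Proof. by rewrite !mulrA F123x F13y F3x F2y. Qed.

Lemma F123_yxxy : F123 (y * x * (y * x * (x * y))) = 1.
Proof.
rewrite !mulrA F123y F23x F2x F12x F13x F12y F2x F1y F0x F1_y.
by rewrite addr0 add0r.
Qed.

Lemma basis_mul4 U V r s u :
    U \in B -> V \in B ->
    U - (r *: x + s *: y) \in (J ^+ 2)%VS ->
    V - (0 *: x + u *: y) \in (J ^+ 2)%VS ->
  r * u = 0.
Proof.
move=> UB VB UE VE; apply/eqP/negPn/negP=> ru0; have [_ mulB _] := fB.
have k0 : (r * u) * (r * u) != 0 by rewrite mulf_neq0.
have UVE : U * V - (r * u) *: (x * y) \in (J ^+ 3)%VS.
  by have := congrJ_mul2 UE VE; rewrite !mulr0 !scale0r addr0 add0r.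
have VUE : V * U - (r * u) *: (y * x) \in (J ^+ 3)%VS.
  by have := congrJ_mul2 VE UE; rewrite !mul0r !scale0r !add0r [u * r]mulrC.
have xyJ : x * y \in (J ^+ 2)%VS by apply: memv_mul.
have yxJ : y * x \in (J ^+ 2)%VS by apply: memv_mul.
have word4 p q p' q' : p - (r * u) *: p' \in (J ^+ 3)%VS ->
    q - (r * u) *: q' \in (J ^+ 3)%VS ->
    p' \in (J ^+ 2)%VS -> q' \in (J ^+ 2)%VS ->
  p * q - (r * u * (r * u)) *: (p' * q') \in (J ^+ 5)%VS.
  move=> pE qE p'J q'J; rewrite -scalerA scalerAr scalerAl.
  apply: (congrJ_mul (k := 2) (l := 2)) => //; first exact: rpredZ.
  by apply: congrJ_memJ qE _; apply: rpredZ.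
have w1E := word4 _ _ _ _ UVE UVE xyJ xyJ.
have w2E := word4 _ _ _ _ VUE VUE yxJ yxJ.
have w3E := word4 _ _ _ _ VUE UVE yxJ xyJ.
(* Both functionals kill J^5, so their values on words in U and V are (r u)^2 times those on words
   in [x] and [y]. *)
have phi w w' : w - (r * u * (r * u)) *: w' \in (J ^+ 5)%VS ->
    F13 w = r * u * (r * u) * F13 w' /\
    F123 (y * x * w) = r * u * (r * u) * F123 (y * x * w').
  move=> ww'; split.
    by rewrite (congrJ_lin F13_vanish ww') linearZ.
  have yxw : y * x * w - y * x * ((r * u * (r * u)) *: w') \in (J ^+ 7)%VS.
    by rewrite -mulrBr; apply: (memJ_mul (k := 2) (l := 5)).
  by rewrite (congrJ_lin F123_vanish yxw) -scalerAr linearZ.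
have [w1a _] := phi _ _ w1E; have [w2a w2b] := phi _ _ w2E.
have [_ w3b] := phi _ _ w3E.
rewrite F13_xyxy mulr0 in w1a; rewrite F13_yxyx mulr1 in w2a.
rewrite F123_yxyx mulr0 in w2b; rewrite F123_yxxy mulr1 in w3b.
have inB p q : p = 0 \/ p \in B -> q = 0 \/ q \in B -> p * q = 0 \/ p * q \in B.
  move=> [->|pB]; first by left; rewrite mul0r.
  by move=> [->|qB]; [left; rewrite mulr0 | apply: mulB].
have UV0B : U * V = 0 \/ U * V \in B by apply: mulB.
have VU0B : V * U = 0 \/ V * U \in B by apply: mulB.
set w1 := U * V * (U * V) in w1E w1a; set w2 := V * U * (V * U) in w2E w2a w2b.
set w3 := V * U * (U * V) in w3E w3b.
have w2B : w2 \in B.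
  have [w20|//] := inB _ _ VU0B VU0B.
  by rewrite -/w2 in w20; rewrite w20 linear0 in w2a; rewrite -w2a eqxx in k0.
have w2J : w2 \notin (J ^+ 5)%VS.
  by apply: contraNN k0 => /F13_vanish; rewrite w2a => ->.
have [f [fw2 f0 fJ]] := filtered_basis_dual fB w2B w2J.
have f0' p q : p = 0 \/ p \in B -> q = 0 \/ q \in B -> p * q != w2 ->
    f (p * q) = 0.
  by move=> pB qB ne; have [->|/f0->//] := inB _ _ pB qB; apply: linear0.
have fw1 : f w1 = 0.
  apply: f0' => //; apply: contraNneq k0 => w12.
  by rewrite -w2a -w12 [F13 _]w1a.
have fw3 : f w3 = 0.
  apply: f0' => //; apply: contraNneq k0 => w32.
  by rewrite -w3b /w3 w32 w2b.
have sumJ : w1 + w2 + w3 \in (J ^+ 5)%VS.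
  have := memvD (memvD w1E w2E) w3E.
  rewrite lin3_sub -(sqr_anticomm x y_sqr) => wJ.
  by have := memvD wJ (memvZ (r * u * (r * u)) comm_sqrJ); rewrite subrK.
have := fJ _ sumJ; rewrite !linearD /= fw1 fw2 fw3 addr0 add0r => /eqP.
by rewrite oner_eq0.
Qed.

Lemma no_filtered_basis : False.
Proof.
have [basisB mulB _] := fB.
have F2yx : F2 (y * x) = 1 by rewrite F2x F1_y.
(* The coefficients modulo J^2 are expressed as linear functionals so that [filtered_basis_detect]
   can impose conditions on them. *)
have coefs W : W \in J -> exists r s,
    [/\ W - (r *: x + s *: y) \in (J ^+ 2)%VS, F2 (y * W) = r & F1 W = s].
  move=> /(jacobson_radical_mod_sqr genG xJ yJ)[r [s WE]]; exists r, s.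
  have yWE : y * W - y * (r *: x + s *: y) \in (J ^+ 3)%VS.
    by rewrite -mulrBr; apply: (memJ_mul (k := 1) (l := 2)).
  split=> //.
    rewrite (congrJ_lin F2_vanish yWE) [y * _]mulrDr -!scalerAr y_sqr.
    by rewrite scaler0 addr0 linearZ /= F2yx; apply: mulr1.
  rewrite (congrJ_lin F1_vanish WE) linearD !linearZ /= F1_x F1_y scaler0 add0r.
  exact: mulr1.
have [U UB [UJ FU]] : exists2 U, U \in B & U \in J /\ F2 (y * U) != 0.
  have [|U UB [UJ]] :=
      @filtered_basis_detect _ _ B
        (ga_fun (fun g => coord2 g) \o amull y) x fB xJ.
    by rewrite /= lfunE /= F2yx oner_neq0.
  by rewrite /= lfunE; exists U.
have [r [s [UE rE sE]]] := coefs U UJ; rewrite rE in FU.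
(* On t x + u y modulo J^2 this is the determinant [r * u - s * t]; at [y] it takes the nonzero
   value [r]. *)
pose f := r \*: ga_fun (fun g => coord1 g) \-
          s \*: (ga_fun (fun g => coord2 g) \o amull y).
have [|V VB [VJ]] := @filtered_basis_detect _ _ B f y fB yJ.
  rewrite /f /= lfunE /= y_sqr linear0 scaler0 subr0 F1_y.
  by rewrite scaler_eq0 negb_or FU oner_neq0.
have [t [u [VE tE uE]]] := coefs V VJ.
rewrite /f /= lfunE /= uE tE subr_eq0 => det.
have := basis_mul2 UB VB UE VE det.
move/eqP; rewrite mulf_eq0 (negPf FU) /= => /eqP t0.
rewrite t0 in VE det; have /eqP := basis_mul4 UB VB UE VE.
rewrite mulf_eq0 (negPf FU) /= => /eqP u0.
by rewrite u0 !scaler0 eqxx in det.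
Qed.

End NoFilteredBasis.

(** * A model of the relations on eight points *)

Section CubeAction.
Local Open Scope group_scope.

(** [stepC] and [stepD] are the translations by which the commutators c and d act. *)
Definition stepC (t : bool * bool * bool) : bool * bool * bool :=
  (t.1.1, ~~ t.1.2, t.2).

Definition stepD (t : bool * bool * bool) : bool * bool * bool :=
  (t.1, ~~ t.2).

Lemma cube_action_relations : exists A B : {perm bool * bool * bool},
  [/\ forall t, A t = stepA t, forall t, B t = stepB t,
      A ^+ 4 = 1, B ^+ 2 = 1 &
  [/\ [~ A, B] ^+ 2 = 1, [~ A, [~ A, B]] ^+ 2 = 1, [~ A, [~ A, [~ A, B]]] = 1 &
  [/\ [~ B, [~ A, B]] = 1, [~ B, [~ A, [~ A, B]]] = 1 &
      [~ [~ A, B], [~ A, [~ A, B]]] = 1]]].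
Proof.
have injA : injective stepA by case=> [[[] []] []] [[[] []] []].
have injB : injective stepB by case=> [[[] []] []] [[[] []] []].
have injC : injective stepC by case=> [[[] []] []] [[[] []] []].
have injD : injective stepD by case=> [[[] []] []] [[[] []] []].
(* This identifies commutators without computing inverse permutations. *)
have commE (g h k : {perm bool * bool * bool}) :
    g * h = h * g * k -> [~ g, h] = k.
  by rewrite commgC => /mulgI.
exists (perm injA), (perm injB); split; try by move=> t; rewrite permE.
- by apply/permP=> -[[[] []] []]; rewrite !expgS expg0 !permM !permE.
- by apply/permP=> -[[[] []] []]; rewrite !expgS expg0 !permM !permE.
have -> : [~ perm injA, perm injB] = perm injC.
  by apply: commE; apply/permP=> -[[[] []] []]; rewrite !permM !permE.
have -> : [~ perm injA, perm injC] = perm injD.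
  by apply: commE; apply/permP=> -[[[] []] []]; rewrite !permM !permE.
split; last split; try apply: commE;
  by apply/permP=> -[[[] []] []]; rewrite ?expgS ?expg0 !permM !permE.
Qed.

Lemma pairX (gT rT : finGroupType) (g : gT) (h : rT) k :
  ((g, h) : gT * rT) ^+ k = (g ^+ k, h ^+ k).
Proof. by elim: k => // k IHk; rewrite !expgS IHk. Qed.

End CubeAction.

(** * Application to the presented group *)

Local Open Scope group_scope.

Theorem theorem3 (K : fieldType) (hK : 2%N \in [pchar K]%R)
    (n : nat) (hn : (1 < n)%N) (gT : finGroupType)
    (hG : [set: gT] \isog Grp (a : b :
        a ^+ (2 ^ n), b ^+ 2, [~ a, b] ^+ 2, [~ a, [~ a, b]] ^+ 2,
        [~ a, [~ a, [~ a, b]]], [~ b, [~ a, b]],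
        [~ b, [~ a, [~ a, b]]], [~ [~ a, b], [~ a, [~ a, b]]])) :
  ~ exists B : seq (group_algebra K gT), filtered_multiplicative_basis B.
Proof.
case=> basis fB; have /existsP[[a b]] := isoGrp_hom hG.
rewrite /= !xpair_eqE /= => /andP[/eqP genG].
case/and5P=> /eqP an /eqP b2 /eqP c2 /eqP d2.
case/and4P=> /eqP ad /eqP bc /eqP bd /eqP cd.
have [A [B [AE BE A4 B2 [C2 D2 AD [BC BD CD]]]]] := cube_action_relations.
(* The condition [1 < n] enters here: 4 divides [2 ^ n]. *)
have An : A ^+ (2 ^ n) = 1.
  by rewrite -(subnK hn) expnD mulnC expgM A4 expg1n.
(* The pairs satisfy the relations in both components, so by the presentation they generate a
   homomorphic image of the group. *)
have cardP : (#|<[(a, A)]> <*> <[(b, B)]>| <= #|gT|)%N.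
  rewrite -cardsT; apply: (leq_homg (C := (<[(a, A)]> <*> <[(b, B)]>)%G)).
  rewrite hG; apply/existsP; exists ((a, A), (b, B)).
  rewrite /=.
  have expE k (g : gT) (h : {perm bool * bool * bool}) :
      g ^+ k = 1 -> h ^+ k = 1 -> (g, h) ^+ k = 1 by rewrite pairX => -> ->.
  have pairE (g : gT) (h : {perm bool * bool * bool}) :
      g = 1 -> h = 1 -> (g, h) = 1 by move=> -> ->.
  apply/eqP; congr (_, (_, (_, (_, (_, (_, (_, (_, _)))))))).
  - exact: expE an An.
  - exact: expE b2 B2.
  - exact: expE c2 C2.
  - exact: expE d2 D2.
  - exact: pairE ad AD.
  - exact: pairE bc BC.
  - exact: pairE bd BD.
  - exact: pairE cd CD.
have [f [fM fa fb]] := graph_morphism genG cardP.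
(* The orbit map of the origin; it is equivariant because permutations compose from left to
   right. *)
pose pi g := f g (false, false, false).
have pi_a g : pi (g * a) = stepA (pi g) by rewrite /pi fM fa permM AE.
have pi_b g : pi (g * b) = stepB (pi g) by rewrite /pi fM fb permM BE.
have [xJ yJ] : (ga_elt K a - 1 \in jacobson_radical (group_algebra K gT) /\
    ga_elt K b - 1 \in jacobson_radical (group_algebra K gT))%R.
  split; apply/mem_jacobson_radical => M maxM;
    have [tMa tMb] := acts_trivially_gens hK genG maxM an b2 c2 d2 ad bc bd.
    by have := tMa 1%R; rewrite mulr1.
  by have := tMb 1%R; rewrite mulr1.
have sqrJ := anticomm_sqrJ hK xJ yJ c2 d2 bc cd.
exact: (no_filtered_basis hK genG xJ yJ pi_a pi_b b2 fB sqrJ).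
Qed.
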